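(* Let $G$ be an independence group and let $n$ be a nonnegative integer. Suppose that $A$ is a subset of $G$ of rank $n$. Let $\mathcal{A}$ be a basis of $A$ and let $\mathcal{B} \subseteq G$ be an independent set with $|\mathcal{B}| = n$. Then $\mathcal{A}$ is matchable to $\mathcal{B}$ relative to $A$ if and only if, for every $J \subseteq \mathcal{A}$, $$\rho\left(\bigcap_{a \in J} (a^{-1}A \cap \mathcal{B})\right) \leq n - |J|,$$ where the intersection is understood to equal $\mathcal{B}$ when $J$ is empty.
   Context: A finitary matroid is a pair $(E,\mathcal{I})$ consisting of a set $E$ and a nonempty collection $\mathcal{I}$ of subsets of $E$ (called the independent sets) such that: (I1) if $A\in\mathcal{I}$ and $B\subseteq A$ then $B\in\mathcal{I}$; (I2) if $A,B$ are finite elements of $\mathcal{I}$ with $|B|=|A|+1$, then there is $x\in B\setminus A$ with $\{x\}\cup A\in\mathcal{I}$; (I3) if $A\subseteq E$ and every finite subset of $A$ belongs to $\mathcal{I}$, then $A\in\mathcal{I}$. The collection $\mathcal{I}$ is called an independence structure on $E$. A basis of a subset $A\subseteq E$ is an independent subset of $A$ that is maximal under inclusion among independent subsets of $A$; bases exist and any two bases of $A$ have the same cardinality, and the rank $\rho(A)$ is that cardinal number. An independence group is a group $G$ (written multiplicatively) together with an independence structure $\mathcal{I}$ on the set $G$ such that for every $g\in G$ and $A\subseteq G$ one has $gA\in\mathcal{I}$ if and only if $A\in\mathcal{I}$, where $gA=\{gx:x\in A\}$. Let $A$ be a finite-rank subset of an independence group $G$, $\mathcal{A}$ a basis of $A$,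 and $\mathcal{B}$ an independent subset of $G$. We say $\mathcal{A}$ is matchable to $\mathcal{B}$ relative to $A$ if there exists a bijection $f:\mathcal{A}\to\mathcal{B}$ such that $af(a)\notin A$ for all $a\in\mathcal{A}$. *)

(* Defs.v *)
From mathcomp Require Import all_boot finmap.
From mathcomp Require Import mathcomp_extra boolp classical_sets functions.
From mathcomp Require Import cardinality.

Set Implicit Arguments.
Unset Strict Implicit.
Unset Printing Implicit Defensive.

Local Open Scope classical_set_scope.
Local Open Scope card_scope.
Local Open Scope group_scope.

(* A finitary matroid whose ground set is the whole type E. *)
Record finitary_matroid (E : choiceType) := FinitaryMatroid {
  indep : set (set E);
  indep_nonempty : indep !=set0;
  indepS : forall A B, indep A -> B `<=` A -> indep B;
  indep_augment : forall (k : nat) A B, A #= `I_k -> B #= `I_k.+1 ->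
    indep A -> indep B -> exists2 x, (B `\` A) x & indep ([set x] `|` A);
  indep_finitary : forall A,
    (forall F, finite_set F -> F `<=` A -> indep F) -> indep A
}.

Section Rank.
Variables (E : choiceType) (M : finitary_matroid E).
Implicit Types A B S : set E.

Definition basis A B :=
  [/\ indep M B, B `<=` A
    & forall S, indep M S -> S `<=` A -> B `<=` S -> S = B].

Lemma basis_exists A : exists B, basis A B.
Proof.
pose P S := indep M S /\ S `<=` A.
have P0 : P set0.
  split; last exact: sub0set.
  have [S indS] := indep_nonempty M; exact: indepS indS (@sub0set _ S).
have [|B [[indB BA] maxB]] := @Zorn_bigcup E P; last first.
  exists B; split=> // S indS SA BS; apply: contrapT => SneB.
  apply: (maxB S); last by split.
  by split=> // SB; apply: SneB; rewrite eqEsubset.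
move=> F FP totF.
have [-> | /set0P[S0 FS0]] := eqVneq F set0; first by rewrite bigcup_set0.
split; last by move=> x [S FS Sx]; have [_] := FP _ FS; apply.
apply: indep_finitary => K finK KF.
suff [S FS KS] : exists2 S, F S & K `<=` S.
  by apply: indepS KS; have [] := FP _ FS.
have /finite_seqP[s Ks] := finK; rewrite {}Ks {finK} in KF *.
elim: s KF => [|x s IHs] KF; first by exists S0.
have [|S FS sS] := IHs; first by move=> y /= ys; apply: KF => /=; rewrite inE ys orbT.
have [|T FT Tx] := KF x; first by rewrite /= mem_head.
have [ST|TS] := totF _ _ FS FT.
- by exists T => // y /=; rewrite inE => /predU1P[->//|ys]; apply/ST/sS.
- by exists S => // y /=; rewrite inE => /predU1P[->|ys]; [apply: TS|apply: sS].
Qed.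

(* The library has no type of cardinals, only the relations #= and #<= between
   sets.  The rank of A, the common cardinal of all bases of A, is therefore
   represented by a chosen basis, to be used only on either side of these
   relations; the default value set0 is never reached, by basis_exists. *)
Definition rank A : set E := xget set0 (basis A).

Lemma rank_basis A : basis A (rank A).
Proof. by have [B AB] := basis_exists A; apply: (xgetPex set0); exists B. Qed.

End Rank.

Definition ltranslate (G : groupType) (g : G) (A : set G) : set G :=
  [set g * x | x in A].

Record independence_group := IndependenceGroup {
  igroup :> groupType;
  istructure : finitary_matroid igroup;
  indep_ltranslate : forall (g : igroup) (A : set igroup),
    indep istructure (ltranslate g A) <-> indep istructure A
}.

(* A bijection between two subsets is represented, as in set_bij, by a
   function on the whole type whose values outside the source are irrelevant. *)
Definition matchable (G : independence_group) (A bA B : set G) :=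
  exists f : G -> G, set_bij bA B f /\ forall a, bA a -> ~ A (a * f a).

(* Main.v *)
Require Import Defs.
From mathcomp Require Import all_boot finmap.
From mathcomp Require Import mathcomp_extra boolp classical_sets functions.
From mathcomp Require Import cardinality.

(** The theorem is Hall's marriage theorem for the bipartite graph joining
    a in bA to b in B when a * b lies outside A.

    Both sides of the graph have n vertices: B by hypothesis, bA because any
    two bases of A are equinumerous ([basis_card]).  Hence a matching of A to
    B is the same thing as an injective choice of a neighbour for every
    a in bA, that is, a transversal.

    For J included in bA, an element b of B lies in a^-1 A for every a in J
    exactly when b has no neighbour in J.  The set whose rank is bounded is
    therefore the complement in B of the neighbourhood of J; as a subset of
    the independent set B it is its own rank ([rank_indep]), so the rank is
    n - |neighbours of J|, and it is at most n - |J| exactly when J satisfies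
    Hall's inequality.

    Hall's theorem ([transversal_hall] and [hall_transversal]) is proved for
    families of finite sets by the argument of Halmos and Vaughan. *)

Local Open Scope classical_set_scope.
Local Open Scope card_scope.
Local Open Scope group_scope.

Definition neighbours {T U : choiceType} (N : T -> {fset U}) (J : {fset T}) :
  {fset U} := (\bigcup_(x <- J) N x)%fset.

Definition transversal {T U : choiceType} (N : T -> {fset U}) (X : {fset T})
  (f : T -> U) := {in X &, injective f} /\ {in X, forall x, f x \in N x}.

Definition hall_condition {T U : choiceType} (N : T -> {fset U})
    (X : {fset T}) :=
  forall J : {fset T}, (J `<=` X)%fset -> #|` J| <= #|` neighbours N J|.

Section Hall.
Context {T U : choiceType}.
Implicit Types (N : T -> {fset U}) (X J K : {fset T}) (W : {fset U}).

Lemma neighboursP {N J y} :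
  reflect (exists2 x, x \in J & y \in N x) (y \in neighbours N J).
Proof.
apply: (iffP (bigfcupP _ _ _ _)) => [[x]|[x xJ yx]].
  by rewrite andbT => ? ?; exists x.
by exists x; rewrite ?andbT.
Qed.

Lemma neighboursU N J K :
  neighbours N (J `|` K)%fset = (neighbours N J `|` neighbours N K)%fset.
Proof.
apply/fsetP => y; rewrite in_fsetU; apply/neighboursP/orP.
  by move=> [x /fsetUP[] xJ yx]; [left|right]; apply/neighboursP; exists x.
by move=> [] /neighboursP[x xJ yx]; exists x; rewrite // in_fsetU xJ ?orbT.
Qed.

Lemma neighboursD N W J :
  neighbours (fun x => N x `\` W)%fset J = (neighbours N J `\` W)%fset.
Proof.
apply/fsetP => y; rewrite in_fsetD; apply/neighboursP/andP.
  by move=> [x xJ /fsetDP[yx yW]]; split=> //; apply/neighboursP; exists x.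
by move=> [yW /neighboursP[x xJ yx]]; exists x; rewrite // in_fsetD yW.
Qed.

Lemma transversal_hall {N X f} : transversal N X f -> hall_condition N X.
Proof.
move=> [f_inj fN] J /fsubsetP JX.
have /card_in_imfsetP/eqP <- : {in J &, injective f}.
  by move=> x y /JX xX /JX yX; apply: f_inj.
apply/fsubset_leq_card/fsubsetP => _ /imfsetP[x /= xJ ->].
by apply/neighboursP; exists x => //; apply/fN/JX.
Qed.

(** The values taken on K stay in W and those taken off K avoid W, so no
    collision can occur between the two pieces. *)
Lemma transversal_glue {N X K W f1 f2} :
  transversal N K f1 -> {in K, forall x, f1 x \in W} ->
  transversal (fun x => N x `\` W)%fset (X `\` K)%fset f2 ->
  transversal N X (fun x => if x \in K then f1 x else f2 x).
Proof.
move=> [f1_inj f1N] f1W [f2_inj f2N].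
have f2P x : x \in X -> x \notin K -> f2 x \in N x /\ f2 x \notin W.
  move=> xX xK; have := f2N x; rewrite !in_fsetD xX xK => /(_ isT).
  by case/andP.
split=> [x y xX yX|x xX]; last first.
  by case: ifPn => xK; [apply: f1N | have [] := f2P x xX xK].
case: ifPn => xK; case: ifPn => yK.
- exact: f1_inj.
- by move=> eqf; have [_] := f2P y yX yK; rewrite -eqf f1W.
- by move=> eqf; have [_] := f2P x xX xK; rewrite eqf f1W.
- by apply: f2_inj; rewrite in_fsetD ?xK ?yK.
Qed.

(** Induction on the number of indices, splitting off a set K of them together
    with the values W reserved for K.  If some nonempty proper K is tight (it has
    no more neighbours than elements), W is its whole neighbourhood, and the
    condition left on the other indices is Hall's inequality for J and K
    together.  If no such K is tight, each
    inequality for a nonempty proper set has one unit to spare, so one index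
    with any one of its neighbours can be split off.  The point y0 serves as a
    value when there is no index at all. *)
Lemma hall_transversal (y0 : U) {N X} :
  hall_condition N X -> exists f, transversal N X f.
Proof.
have [n] := ubnP #|` X|; elim: n N X => // n IHn N X leXn hallX.
(* The hypothesis on J says that removing W leaves Hall's inequality true
   for the indices outside K. *)
have step K W f1 : (K `<=` X)%fset -> K != fset0 ->
    transversal N K f1 -> {in K, forall x, f1 x \in W} ->
    (forall J, (J `<=` X `\` K)%fset -> J != fset0 ->
      #|` J| + #|` W| <= #|` (neighbours N J `|` W)%fset|) ->
    exists f, transversal N X f.
  move=> KX K0 f1K f1W hallXK.
  have [||f2 f2XK] := IHn (fun x => N x `\` W)%fset (X `\` K)%fset.
  - rewrite -ltnS; apply: leq_trans leXn; rewrite ltnS cardfsDS //.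
    by rewrite ltn_subrL !cardfs_gt0 K0; apply: contraNneq K0 => X0;
       rewrite -fsubset0 -X0.
  - move=> J JXK; have [->|J0] := eqVneq J fset0; first by rewrite cardfs0.
    rewrite neighboursD -(leq_add2r #|` W|); apply: leq_trans (hallXK J JXK J0) _.
    by rewrite cardfsU cardfsD addnBAC // fsubset_leq_card // fsubsetIl.
  by eexists; apply: (transversal_glue f1K f1W f2XK).
have [[K [KX K0 KN]]|noK] :=
    pselect (exists K, [/\ (K `<` X)%fset, K != fset0 &
                           #|` neighbours N K| <= #|` K|]).
  have [||f1 f1K] := IHn N K.
  - by rewrite -ltnS (leq_trans _ leXn) // ltnS fproper_ltn_card.
  - by move=> J JK; apply/hallX/(fsubset_trans JK)/fproper_sub.
  apply: (step K (neighbours N K) f1) => //; first exact: fproper_sub.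
  - by move=> x xK; apply/neighboursP; exists x => //; have [_] := f1K; apply.
  move=> J JXK _; rewrite -neighboursU.
  have [JX /eqP dJK] : (J `<=` X)%fset /\ (J `&` K)%fset == fset0.
    by move: JXK; rewrite fsubsetD -fsetI_eq0 => /andP[-> ->].
  apply: leq_trans (hallX _ _); last first.
    by rewrite fsubUset JX fproper_sub.
  by rewrite cardfsU dJK cardfs0 subn0 leq_add2l.
have [->|/fset0Pn[x xX]] := eqVneq X fset0.
  by exists (fun=> y0).
have [y yx] : exists y, y \in N x.
  apply/fset0Pn; rewrite -cardfs_gt0.
  have := hallX [fset x]%fset; rewrite fsub1set cardfs1 => /(_ xX).
  by rewrite /neighbours big_seq_fset1.
apply: (step [fset x]%fset [fset y]%fset (fun=> y)).
- by rewrite fsub1set.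
- by apply/fset0Pn; exists x; rewrite inE.
- by split=> [a b|a]; rewrite !inE => /eqP-> // /eqP->.
- by move=> a _; rewrite inE.
move=> J; rewrite fsubsetD1 => /andP[JX xJ] J0; rewrite cardfs1 addn1.
apply: leq_trans (fsubset_leq_card (fsubsetUl _ _)).
rewrite ltnNge; apply/negP => JN; apply: noK; exists J; split=> //.
by rewrite fproperEneq JX andbT; apply: contraNneq xJ => ->.
Qed.

End Hall.

Section Bases.
Context {E : choiceType} {M : finitary_matroid E}.
Implicit Types A : set E.

(** Otherwise augmentation from a subset of Y with one more element than X
    would enlarge the basis inside A. *)
Lemma indep_leq_basis {A} {X Y : {fset E}} :
  basis M A [set` X] -> indep M [set` Y] -> [set` Y] `<=` A ->
  #|` Y| <= #|` X|.
Proof.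
move=> [indX XA maxX] indY YA; rewrite leqNgt; apply/negP => ltXY.
have [Z ZY cardZ] : exists2 Z : {fset E}, (Z `<=` Y)%fset & #|` Z| = #|` X|.+1.
  exists [fset z in take #|` X|.+1 Y]%fset.
    by apply/fsubsetP => z; rewrite inE => /mem_take.
  by rewrite card_fseq undup_id ?take_uniq // size_takel.
have subZY : [set` Z] `<=` [set` Y] by move=> z; apply: (fsubsetP ZY).
have [||||x [Zx Xx] indxX] := @indep_augment _ M #|` X| [set` X] [set` Z].
- exact/card_eq_fsetP.
- exact/card_eq_fsetP.
- by [].
- exact: indepS indY subZY.
apply: Xx; rewrite -(maxX _ indxX); first by left.
- by move=> z [->|/XA//]; apply/YA/subZY.
- by move=> z Xz; right.
Qed.

(** The second basis is finite because each of its finite subsets is no larger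
    than the first one; both bases being finite, the comparison is symmetric. *)
Lemma basis_card {A S1 S2 : set E} {n : nat} :
  basis M A S1 -> S1 #= `I_n -> basis M A S2 -> S2 #= `I_n.
Proof.
move=> basis1 card1 basis2.
have /finite_fsetP[X eqX] : finite_set S1 by apply/finite_setP; exists n.
rewrite {}eqX in basis1 card1.
have [ind1 sub1 _] := basis1; have [ind2 sub2 _] := basis2.
have leX (Y : {fset E}) : [set` Y] `<=` S2 -> #|` Y| <= #|` X|.
  by move=> YS; apply: (indep_leq_basis basis1) (indepS ind2 YS) _ => z /YS/sub2.
have : finite_set S2.
  apply: contrapT => /(infinite_set_fset #|` X|.+1)[Y /leX leYX].
  by rewrite ltnNge leYX.
move=> /finite_fsetP[Y eqY]; rewrite {}eqY in basis2 ind2 sub2 leX *.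
apply/card_eq_fsetP; rewrite -(card_eq_fsetP card1).
by apply/eqP; rewrite eqn_leq leX //= (indep_leq_basis basis2).
Qed.

(** An independent set is its only basis, so the chosen one is S itself. *)
Lemma rank_indep {S : set E} : indep M S -> rank M S = S.
Proof.
move=> indS; have [_ subS maxS] := rank_basis M S.
by rewrite [RHS]maxS.
Qed.

End Bases.

Theorem theorem4p2 (G : independence_group) (n : nat) (A bA B : set G)
    (rankA : rank (istructure G) A #= `I_n)
    (basis_bA : basis (istructure G) A bA)
    (indepB : indep (istructure G) B)
    (cardB : B #= `I_n) :
  matchable A bA B <->
  forall J : set G, J `<=` bA ->
    rank (istructure G)
      (B `&` \bigcap_(a in J) (ltranslate a^-1 A `&` B))
    #<= `I_(n - #|` fset_set J |).
Proof.
have cardbA : bA #= `I_n := basis_card (rank_basis _ _) rankA basis_bA.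
have /finite_fsetP[X eqX] : finite_set bA by apply/finite_setP; exists n.
have /finite_fsetP[Y eqY] : finite_set B by apply/finite_setP; exists n.
rewrite {bA}eqX {B}eqY in basis_bA indepB cardB cardbA *.
have cardX := card_eq_fsetP cardbA; have cardY := card_eq_fsetP cardB.
pose N a : {fset G} := [fset b in Y | `[< ~ A (a * b) >]]%fset.
have N_Y J : (neighbours N J `<=` Y)%fset.
  by apply/fsubsetP => b /neighboursP[a _]; rewrite !inE => /andP[].
have rankE (J : {fset G}) : rank (istructure G)
    ([set` Y] `&` \bigcap_(a in [set` J]) (ltranslate a^-1 A `&` [set` Y]))
    = [set` (Y `\` neighbours N J)%fset].
  rewrite rank_indep; last by apply: indepS indepB _ => b [].
  apply/seteqP; split=> b /=.
    move=> [Yb capb]; rewrite in_fsetD Yb andbT; apply/neighboursP => -[a aJ].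
    rewrite !inE => /andP[_ /asboolP]; apply.
    by have [[c Ac <-] _] := capb a aJ; rewrite mulVKg.
  rewrite in_fsetD => /andP[nb Yb]; split=> // a aJ; split=> //.
  exists (a * b); last by rewrite mulKg.
  apply: contrapT => nA; move/negP: nb; apply; apply/neighboursP.
  by exists a => //; rewrite !inE Yb; apply/asboolP.
have hallE : hall_condition N X <->
    forall J : set G, J `<=` [set` X] ->
    rank (istructure G)
      ([set` Y] `&` \bigcap_(a in J) (ltranslate a^-1 A `&` [set` Y]))
    #<= `I_(n - #|` fset_set J |).
  have cardE (J : {fset G}) : (J `<=` X)%fset ->
      ([set` (Y `\` neighbours N J)%fset] #<= `I_(n - #|` J |)) =
      (#|` J| <= #|` neighbours N J|).
    move=> JX.
    have leJ : #|` J| <= n by rewrite -cardX fsubset_leq_card.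
    have /card_eqPle[le1 le2] :
        [set` (Y `\` neighbours N J)%fset] #= `I_(n - #|` neighbours N J|).
      by apply/card_eq_fsetP; rewrite cardfsDS // cardY.
    rewrite -(leq_sub2lE _ leJ) // -card_le_II.
    by apply/idP/idP; apply: card_le_trans.
  split=> [hall J JX|hall J JX].
    have /finite_fsetP[K eqK] : finite_set J by apply: sub_finite_set JX _.
    rewrite {J}eqK in JX *; rewrite set_fsetK rankE.
    have KX : (K `<=` X)%fset by apply/fsubsetP => x /JX.
    by rewrite cardE ?hall.
  have := hall [set` J]; rewrite set_fsetK rankE cardE //; apply.
  by move=> x /(fsubsetP JX).
rewrite -hallE; split=> [[f [[fXY f_inj _] fA]]|].
  apply: (@transversal_hall _ _ N X f); split=> [x y xX yX|x xX].
    by apply: f_inj; rewrite inE.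
  by rewrite !inE (fXY x) //=; apply/asboolP/fA.
move=> /(hall_transversal (1 : G))[f [f_inj fN]]; exists f; split; last first.
  by move=> a /fN; rewrite !inE => /andP[_ /asboolP].
(* An injection between two sets of n elements is onto. *)
have fX_Y : (f @` X)%fset = Y.
  apply/eqP; rewrite eqEfcard; apply/andP; split.
    by apply/fsubsetP => _ /imfsetP[x /= /fN + ->]; rewrite !inE => /andP[].
  by move/card_in_imfsetP: f_inj => /eqP->; rewrite cardX cardY.
split.
- by move=> x /= xX; rewrite -fX_Y in_imfset.
- by move=> x y; rewrite !inE; apply: f_inj.
- by move=> y /=; rewrite -fX_Y => /imfsetP[x /= xX ->]; exists x.
Qed.
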